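(* The following relations hold in $U_q(\mathfrak{sl}_2)$: \begin{align*} x^2y^2 &= 1-q^{-2}(q+q^{-1})\nu_z + q^{-4}\nu_z^2, \\ y^2z^2 &= 1-q^{-2}(q+q^{-1})\nu_x + q^{-4}\nu_x^2,\\ z^2x^2 &= 1-q^{-2}(q+q^{-1})\nu_y + q^{-4}\nu_y^2,\\ y^2x^2 &= 1-q^2(q+q^{-1})\nu_z + q^4\nu_z^2, \\ z^2y^2 &= 1-q^2(q+q^{-1})\nu_x + q^4\nu_x^2, \\ x^2z^2 &= 1-q^2(q+q^{-1})\nu_y + q^4\nu_y^2. \end{align*}
   Context: $\mathbb K$ is a field and $q$ is a nonzero scalar in $\mathbb K$ with $q^2\neq 1$. $U_q(\mathfrak{sl}_2)$ is the unital associative $\mathbb K$-algebra with generators $x,y,y^{-1},z$ and relations $yy^{-1}=y^{-1}y=1$, $\frac{qxy-q^{-1}yx}{q-q^{-1}}=1$, $\frac{qyz-q^{-1}zy}{q-q^{-1}}=1$, $\frac{qzx-q^{-1}xz}{q-q^{-1}}=1$. In $U_q(\mathfrak{sl}_2)$: $\nu_x=q(1-yz)=q^{-1}(1-zy)$, $\nu_y=q(1-zx)=q^{-1}(1-xz)$, $\nu_z=q(1-xy)=q^{-1}(1-yx)$. *)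

(* Defs.v *)
From HB Require Import structures.
From mathcomp Require Import all_boot all_order all_algebra.
From mathcomp Require Import boolp.
From mathcomp Require Import monalg.

Set Implicit Arguments.
Unset Strict Implicit.
Unset Printing Implicit Defensive.

Import GRing.Theory.
Local Open Scope ring_scope.
Local Open Scope quotient_scope.

Lemma malg_scaleAr (K : comNzRingType) (M : monomType) (c : K)
  (u v : {malg K[M]}) : c *: (u * v) = u * (c *: v).
Proof.
rewrite [u * v]malgME [RHS](fgmulrw (finmap.fsubset_refl _) (msuppZ_le c v)).
rewrite exchange_big scaler_sumr; apply: eq_bigr => k _.
rewrite scaler_sumr; apply: eq_bigr => l _.
by apply/malgP => m; rewrite !mcoeffZ !mcoeffU mulrnAr mulrCA.
Qed.

(* [{fmonom 'I_n}] is the monoid of words in n letters, so [free_alg K n] is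
   the algebra of noncommutative polynomials in n variables over K. *)
Definition free_alg (K : comNzRingType) (n : nat) : Type :=
  {malg K[{fmonom 'I_n}]}.

HB.instance Definition _ (K : comNzRingType) (n : nat) :=
  GRing.Lalgebra.on (free_alg K n).

HB.instance Definition _ (K : comNzRingType) (n : nat) :=
  GRing.Lalgebra_isAlgebra.Build K (free_alg K n)
    (@malg_scaleAr K {fmonom 'I_n}).

Definition free_var (K : comNzRingType) (n : nat) (i : 'I_n) : free_alg K n :=
  << fmu i >>.

(* The two-sided ideal generated by a list of elements. *)
Inductive ideal_gen (A : nzRingType) (s : seq A) : A -> Prop :=
| IdealGen u of u \in s : ideal_gen s u
| IdealGen0 : ideal_gen s 0
| IdealGenD u v of ideal_gen s u & ideal_gen s v : ideal_gen s (u + v)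
| IdealGenM a u b of ideal_gen s u : ideal_gen s (a * u * b).

Section IdealPred.
Variables (A : nzRingType) (s : seq A).

Definition ideal_pred : {pred A} := fun u => `[< ideal_gen s u >].

Fact ideal_pred_zmod : zmod_closed ideal_pred.
Proof.
split=> [|u v]; first by apply/asboolP; exact: IdealGen0.
move=> /asboolP su /asboolP sv; apply/asboolP/IdealGenD => //.
by rewrite -[v]mulr1 -mulN1r mulrA; exact: IdealGenM.
Qed.

HB.instance Definition _ := GRing.isZmodClosed.Build A ideal_pred ideal_pred_zmod.

Lemma ideal_predM a u b : u \in ideal_pred -> a * u * b \in ideal_pred.
Proof. by move=> /asboolP su; apply/asboolP/IdealGenM. Qed.

End IdealPred.

(* The quotient of A by the two-sided ideal generated by s. MathComp's rings
   satisfy 1 != 0, so the ideal is required to be proper. *)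
Definition ideal_quotient (A : nzRingType) (s : seq A)
  (s_proper : ~ ideal_gen s 1) : Type := {ideal_quot (ideal_pred s)}.

Section IdealQuotientRing.
Variables (A : nzRingType) (s : seq A) (s_proper : ~ ideal_gen s 1).

Local Notation Q := (ideal_quotient s_proper).
Local Notation I := (ideal_pred s).

HB.instance Definition _ := GRing.Zmodule.on Q.

Definition quo (u : A) : Q := \pi_({ideal_quot I}) u.

Let rep (a : Q) : A := repr (a : {ideal_quot I}).

Let repK a : quo (rep a) = a.
Proof. exact: reprK. Qed.

Lemma quo_eq u v : (quo u = quo v) <-> ideal_gen s (u - v).
Proof.
split; first by move=> /eqP; rewrite -Quotient.idealrBE => /asboolP.
by move=> /asboolP uv; apply/eqP; rewrite -Quotient.idealrBE.
Qed.

Let rep_quo u : u - rep (quo u) \in I.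
Proof. by apply/asboolP/quo_eq; rewrite repK. Qed.

Lemma quoD u v : quo (u + v) = quo u + quo v.
Proof. exact: (raddfD \pi_({ideal_quot I})). Qed.

Lemma quoN u : quo (- u) = - quo u.
Proof. exact: (raddfN \pi_({ideal_quot I})). Qed.

Definition quo_one : Q := quo 1.
Definition quo_mul (a b : Q) : Q := quo (rep a * rep b).

Lemma quoM_def u v : quo (u * v) = quo_mul (quo u) (quo v).
Proof.
apply/quo_eq/asboolP.
have -> : u * v - rep (quo u) * rep (quo v)
  = 1 * (u - rep (quo u)) * v + rep (quo u) * (v - rep (quo v)) * 1.
  by rewrite mul1r mulr1 mulrBl mulrBr addrA subrK.
by apply: (@rpredD _ I); apply: ideal_predM.
Qed.

Fact quo_mulA : associative quo_mul.
Proof.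
by move=> a b c; rewrite -(repK a) -(repK b) -(repK c) -!quoM_def mulrA.
Qed.

Fact quo_mul1l : left_id quo_one quo_mul.
Proof. by move=> a; rewrite -(repK a) -quoM_def mul1r. Qed.

Fact quo_mul1r : right_id quo_one quo_mul.
Proof. by move=> a; rewrite -(repK a) -quoM_def mulr1. Qed.

Fact quo_mulDl : left_distributive quo_mul +%R.
Proof.
move=> a b c; rewrite -(repK a) -(repK b) -(repK c).
by rewrite -quoD -!quoM_def mulrDl quoD.
Qed.

Fact quo_mulDr : right_distributive quo_mul +%R.
Proof.
move=> a b c; rewrite -(repK a) -(repK b) -(repK c).
by rewrite -quoD -!quoM_def mulrDr quoD.
Qed.

Fact quo_one_neq0 : quo_one != 0.
Proof.
apply/eqP => /(etrans _)-/(_ (quo 1) erefl).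
have <- : quo 0 = 0 by exact: (raddf0 \pi_({ideal_quot I})).
by move=> /quo_eq; rewrite subr0.
Qed.

HB.instance Definition _ := GRing.Zmodule_isNzRing.Build Q
  quo_mulA quo_mul1l quo_mul1r quo_mulDl quo_mulDr quo_one_neq0.

Lemma quoM u v : quo (u * v) = quo u * quo v.
Proof. exact: quoM_def. Qed.

Lemma quo1 : quo 1 = 1.
Proof. by []. Qed.

End IdealQuotientRing.

Section IdealQuotientAlgebra.
Variables (K : comNzRingType) (A : algType K) (s : seq A).
Variable s_proper : ~ ideal_gen s 1.

Local Notation Q := (ideal_quotient s_proper).
Local Notation quo := (quo s_proper).

Definition quo_scale (c : K) (a : Q) : Q := quo c%:A * a.

Lemma quoZ_def c u : quo (c *: u) = quo_scale c (quo u).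
Proof. by rewrite /quo_scale -quoM -scalerAl mul1r. Qed.

Fact quo_scaleA c d a : quo_scale c (quo_scale d a) = quo_scale (c * d) a.
Proof. by rewrite /quo_scale mulrA -quoM -scalerAl mul1r scalerA. Qed.

Fact quo_scale1 : left_id 1 quo_scale.
Proof. by move=> a; rewrite /quo_scale scale1r quo1 mul1r. Qed.

Fact quo_scaleDr : right_distributive quo_scale +%R.
Proof. by move=> c a b; rewrite /quo_scale mulrDr. Qed.

Fact quo_scaleDl a : {morph quo_scale^~ a : c d / c + d}.
Proof. by move=> c d; rewrite /quo_scale scalerDl quoD mulrDl. Qed.

HB.instance Definition _ := GRing.Zmodule_isLmodule.Build K Q
  quo_scaleA quo_scale1 quo_scaleDr quo_scaleDl.

Lemma quoZ c u : quo (c *: u) = c *: quo u.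
Proof. exact: quoZ_def. Qed.

Fact quo_scaleAl (c : K) (a b : Q) : c *: (a * b) = c *: a * b.
Proof. exact: mulrA. Qed.

HB.instance Definition _ := GRing.Lmodule_isLalgebra.Build K Q quo_scaleAl.

Fact quo_scaleAr (c : K) (a b : Q) : c *: (a * b) = a * (c *: b).
Proof.
have -> : a = quo (repr (a : {ideal_quot (ideal_pred s)})).
  by rewrite /quo reprK.
have -> : b = quo (repr (b : {ideal_quot (ideal_pred s)})).
  by rewrite /quo reprK.
by rewrite -quoM -!quoZ -quoM scalerAr.
Qed.

HB.instance Definition _ := GRing.Lalgebra_isAlgebra.Build K Q quo_scaleAr.

End IdealQuotientAlgebra.

Lemma mem_seq5 (T : eqType) (a b c d e : T) (s := [:: a; b; c; d; e]) :
  [/\ a \in s, b \in s, c \in s, d \in s & e \in s].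
Proof. by rewrite !inE !eqxx !orbT. Qed.

Lemma all_seq5 (T : eqType) (p : pred T) (a b c d e : T) :
  [/\ p a, p b, p c, p d & p e] -> all p [:: a; b; c; d; e].
Proof. by case=> /= -> -> -> -> ->. Qed.

Section Relators.
Variables (K : fieldType) (q : K).

(* q_comm u v = 1 is the relation (q u v - q^-1 v u) / (q - q^-1) = 1. *)
Definition q_comm (A : algType K) (u v : A) : A :=
  (q - q^-1)^-1 *: (q *: (u * v) - q^-1 *: (v * u)).

Definition free_x  : free_alg K 4 := free_var K (inord 0).
Definition free_y  : free_alg K 4 := free_var K (inord 1).
Definition free_yinv : free_alg K 4 := free_var K (inord 2).
Definition free_z  : free_alg K 4 := free_var K (inord 3).

Definition Uq_relators : seq (free_alg K 4) :=
  [:: free_y * free_yinv - 1;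
      free_yinv * free_y - 1;
      q_comm free_x free_y - 1;
      q_comm free_y free_z - 1;
      q_comm free_z free_x - 1].

End Relators.

Section Augmentation.
Variables (K : fieldType) (n : nat).

Definition all_one (m : {fmonom 'I_n}) : K := 1.

Fact all_one_mmorphism : mmorphism all_one.
Proof. by split=> // m1 m2; rewrite /all_one mulr1. Qed.

HB.instance Definition _ := isMultiplicative.Build _ _ all_one all_one_mmorphism.

Lemma free_alg_augmentation : exists f : {rmorphism free_alg K n -> K},
  (forall i, f (free_var K i) = 1) /\ (forall c u, f (c *: u) = c * f u).
Proof.
pose f : {rmorphism free_alg K n -> K} := mmap idfun all_one.
exists f; split=> [i|c u]; last exact: mmapZ.
by rewrite /f /= mmapU mulr1.
Qed.

End Augmentation.

Section Uq.
Variables (K : fieldType) (q : K).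
Hypotheses (q_neq0 : q != 0) (q2_neq1 : q ^+ 2 != 1).

Lemma q_subV_neq0 : q - q^-1 != 0.
Proof.
rewrite subr_eq0; apply: contra q2_neq1 => /eqP qV.
by rewrite expr2 {1}qV mulVf.
Qed.

Lemma q_comm_eq1 (A : algType K) (u v : A) :
  q_comm q u v = 1 -> q *: (1 - u * v) = q^-1 *: (1 - v * u).
Proof.
move=> /(congr1 ( *:%R (q - q^-1))).
rewrite scalerA mulfV ?q_subV_neq0 // scale1r scalerBl => quv.
apply/eqP; rewrite !scalerBr subr_eq -addrA [- _ + _]addrC quv.
by rewrite addrC subrK.
Qed.

Lemma rmorph_q_comm (A : algType K) (f : {rmorphism A -> K}) (u v : A) :
  (forall c w, f (c *: w) = c * f w) -> f u = 1 -> f v = 1 ->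
  f (q_comm q u v) = 1.
Proof.
move=> fZ fu fv; rewrite /q_comm fZ rmorphB !fZ !rmorphM fu fv !mulr1.
by rewrite mulVf // q_subV_neq0.
Qed.

Lemma quo_q_comm (A : algType K) (s : seq A) (s_proper : ~ ideal_gen s 1)
  (u v : A) :
  quo s_proper (q_comm q u v) = q_comm q (quo s_proper u) (quo s_proper v).
Proof. by rewrite /q_comm quoZ quoD quoN !quoZ !quoM. Qed.

(* The generators all map to 1 under an algebra morphism to K, so the relations
   do not collapse the free algebra. *)
Fact Uq_proper : ~ ideal_gen (Uq_relators q) 1.
Proof.
have [f [f_var fZ]] := free_alg_augmentation K 4.
have f_comm i j : f (q_comm q (free_var K i) (free_var K j) - 1) = 0.
  by rewrite rmorphB rmorph1 rmorph_q_comm // subrr.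
have f0 u : ideal_gen (Uq_relators q) u -> f u = 0.
  elim=> {u} [u||u v _ u0 _ v0|a u b _ u0]; last 3 first.
  - exact: rmorph0.
  - by rewrite rmorphD u0 v0 addr0.
  - by rewrite !rmorphM u0 mulr0 mul0r.
  have f_prod i j : f (free_var K i * free_var K j - 1) = 0.
    by rewrite rmorphB rmorph1 rmorphM !f_var mulr1 subrr.
  suff /allP rel0 : all (fun v => f v == 0) (Uq_relators q) by move=> /rel0/eqP.
  apply/all_seq5; split; apply/eqP.
  - exact: f_prod.
  - exact: f_prod.
  - exact: f_comm.
  - exact: f_comm.
  - exact: f_comm.
by move=> /f0/eqP; rewrite rmorph1 oner_eq0.
Qed.

(* U_q(sl_2): the free algebra on x, y, y^-1, z modulo the two-sided ideal
   generated by the defining relations. *)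
Definition Uq : Type := ideal_quotient Uq_proper.

HB.instance Definition _ := GRing.Algebra.on Uq.

Definition Uq_x : Uq := quo Uq_proper (free_x K).
Definition Uq_y : Uq := quo Uq_proper (free_y K).
Definition Uq_yinv : Uq := quo Uq_proper (free_yinv K).
Definition Uq_z : Uq := quo Uq_proper (free_z K).

Definition nu_x : Uq := q *: (1 - Uq_y * Uq_z).
Definition nu_y : Uq := q *: (1 - Uq_z * Uq_x).
Definition nu_z : Uq := q *: (1 - Uq_x * Uq_y).

Lemma mem_Uq_relators :
  [/\ free_y K * free_yinv K - 1 \in Uq_relators q,
      free_yinv K * free_y K - 1 \in Uq_relators q,
      q_comm q (free_x K) (free_y K) - 1 \in Uq_relators q,
      q_comm q (free_y K) (free_z K) - 1 \in Uq_relators q &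
      q_comm q (free_z K) (free_x K) - 1 \in Uq_relators q].
Proof. exact: mem_seq5. Qed.

Lemma quo_relator u : u - 1 \in Uq_relators q -> quo Uq_proper u = 1.
Proof. by move=> ru; rewrite -quo1; apply/quo_eq; exact: IdealGen. Qed.

Lemma Uq_y_yinv : Uq_y * Uq_yinv = 1.
Proof.
rewrite -[LHS]quoM; apply: quo_relator.
by have [h _ _ _ _] := mem_Uq_relators; exact: h.
Qed.

Lemma Uq_yinv_y : Uq_yinv * Uq_y = 1.
Proof.
rewrite -[LHS]quoM; apply: quo_relator.
by have [_ h _ _ _] := mem_Uq_relators; exact: h.
Qed.

Lemma Uq_xy : q_comm q Uq_x Uq_y = 1.
Proof.
rewrite -[LHS]quo_q_comm; apply: quo_relator.
by have [_ _ h _ _] := mem_Uq_relators; exact: h.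
Qed.

Lemma Uq_yz : q_comm q Uq_y Uq_z = 1.
Proof.
rewrite -[LHS]quo_q_comm; apply: quo_relator.
by have [_ _ _ h _] := mem_Uq_relators; exact: h.
Qed.

Lemma Uq_zx : q_comm q Uq_z Uq_x = 1.
Proof.
rewrite -[LHS]quo_q_comm; apply: quo_relator.
by have [_ _ _ _ h] := mem_Uq_relators; exact: h.
Qed.

Lemma nu_xE : nu_x = q^-1 *: (1 - Uq_z * Uq_y).
Proof. exact: q_comm_eq1 Uq_yz. Qed.

Lemma nu_yE : nu_y = q^-1 *: (1 - Uq_x * Uq_z).
Proof. exact: q_comm_eq1 Uq_zx. Qed.

Lemma nu_zE : nu_z = q^-1 *: (1 - Uq_y * Uq_x).
Proof. exact: q_comm_eq1 Uq_xy. Qed.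

End Uq.

(* Main.v *)
Require Import Defs.
From mathcomp Require Import all_boot all_order all_algebra.

Set Implicit Arguments.
Unset Strict Implicit.
Unset Printing Implicit Defensive.

Import GRing.Theory.
Local Open Scope ring_scope.

(** Write n for one of nu_x, nu_y, nu_z, and (u, v) for the pair (y, z), (z, x),
    (x, y) respectively, so that u v = 1 - q^-1 n and v u = 1 - q n.
    Associativity of u v u forces u n = q^-2 n u ([q_commute_nu]).  In
    u^2 v^2 = u (u v) v the inner factor 1 - q^-1 n therefore moves to the left
    of u and becomes 1 - q^-3 n, which gives the factorization
      u^2 v^2 = (1 - q^-3 n) (1 - q^-1 n);
    expanding it is [sqr_mul_sqr].  The hypotheses are invariant under
    exchanging u with v and q with q^-1, so the same lemma also computes
    v^2 u^2 ([sqr_mul_sqr_swap]).  Cyclic symmetry in x, y, z accounts for the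
    three cases of each formula. *)

Section EquitablePair.
Variables (K : fieldType) (A : algType K).

(** Up to powers of q, both sides are u - u v u: bracketed as u (1 - v u) on
    the left, as (1 - u v) u on the right. *)
Lemma q_commute_nu (q : K) (u v n : A) : q != 0 ->
  n = q *: (1 - u * v) -> n = q^-1 *: (1 - v * u) -> u * n = q ^- 2 *: (n * u).
Proof.
move=> q0 n_uv n_vu.
rewrite {1}n_vu n_uv -scalerAr -scalerAl scalerA mulrBr mulrBl mulr1 mul1r mulrA.
by rewrite expr2 invfM mulfVK.
Qed.

Lemma sqr_mul_sqr (q : K) (u v n : A) : q != 0 ->
  n = q *: (1 - u * v) -> n = q^-1 *: (1 - v * u) ->
  u ^+ 2 * v ^+ 2 = 1 - (q ^- 2 * (q + q^-1)) *: n + q ^- 4 *: n ^+ 2.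
Proof.
move=> q0 n_uv n_vu.
have un := q_commute_nu q0 n_uv n_vu.
have uv : u * v = 1 - q^-1 *: n.
  by rewrite n_uv scalerA mulVf // scale1r opprB addrC subrK.
(* The inner 1 - q^-1 n of u (u v) v, moved left across u, picks up q^-2. *)
have -> : u ^+ 2 * v ^+ 2 = (1 - q ^- 3 *: n) * (u * v).
  rewrite !expr2 -mulrA [u * (v * v)]mulrA {1}uv mulrA mulrBr mulr1 -scalerAr un.
  by rewrite scalerA -invfM -exprS [RHS]mulrA [(1 - _) * u]mulrBl mul1r -scalerAl.
rewrite uv mulrBr mulr1 mulrBl mul1r -scalerAl -scalerAr scalerA -expr2.
rewrite -invfM -exprSr opprB addrA addrAC -[1 - _ - _]addrA -opprD -scalerDl.
by rewrite mulrDr -invfM -exprSr [_ + q ^- 3]addrC; congr (_ - (_ + _) *: _ + _);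
  rewrite expr2 invfM mulfVK.
Qed.

(** This is [sqr_mul_sqr] for (v, u) with q^-1 in place of q. *)
Lemma sqr_mul_sqr_swap (q : K) (u v n : A) : q != 0 ->
  n = q *: (1 - u * v) -> n = q^-1 *: (1 - v * u) ->
  v ^+ 2 * u ^+ 2 = 1 - (q ^+ 2 * (q + q^-1)) *: n + q ^+ 4 *: n ^+ 2.
Proof.
move=> q0 n_uv n_vu.
have qV0 : q^-1 != 0 by rewrite invr_eq0.
have n_uv' : n = q^-1^-1 *: (1 - u * v) by rewrite invrK.
by rewrite (sqr_mul_sqr qV0 n_vu n_uv') !exprVn !invrK [q^-1 + q]addrC.
Qed.

End EquitablePair.

Theorem lemma3p5 (K : fieldType) (q : K) (q_neq0 : q != 0)
  (q2_neq1 : q ^+ 2 != 1) :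
  let x : Uq q_neq0 q2_neq1 := Uq_x q_neq0 q2_neq1 in
  let y : Uq q_neq0 q2_neq1 := Uq_y q_neq0 q2_neq1 in
  let z : Uq q_neq0 q2_neq1 := Uq_z q_neq0 q2_neq1 in
  let nux : Uq q_neq0 q2_neq1 := nu_x q_neq0 q2_neq1 in
  let nuy : Uq q_neq0 q2_neq1 := nu_y q_neq0 q2_neq1 in
  let nuz : Uq q_neq0 q2_neq1 := nu_z q_neq0 q2_neq1 in
  (x ^+ 2 * y ^+ 2 = 1 - (q ^- 2 * (q + q^-1)) *: nuz + q ^- 4 *: nuz ^+ 2) /\
  (y ^+ 2 * z ^+ 2 = 1 - (q ^- 2 * (q + q^-1)) *: nux + q ^- 4 *: nux ^+ 2) /\
  (z ^+ 2 * x ^+ 2 = 1 - (q ^- 2 * (q + q^-1)) *: nuy + q ^- 4 *: nuy ^+ 2) /\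
  (y ^+ 2 * x ^+ 2 = 1 - (q ^+ 2 * (q + q^-1)) *: nuz + q ^+ 4 *: nuz ^+ 2) /\
  (z ^+ 2 * y ^+ 2 = 1 - (q ^+ 2 * (q + q^-1)) *: nux + q ^+ 4 *: nux ^+ 2) /\
  (x ^+ 2 * z ^+ 2 = 1 - (q ^+ 2 * (q + q^-1)) *: nuy + q ^+ 4 *: nuy ^+ 2).
Proof.
move=> x y z nux nuy nuz.
have nuxE : nux = q^-1 *: (1 - z * y) := nu_xE q_neq0 q2_neq1.
have nuyE : nuy = q^-1 *: (1 - x * z) := nu_yE q_neq0 q2_neq1.
have nuzE : nuz = q^-1 *: (1 - y * x) := nu_zE q_neq0 q2_neq1.
split; first exact: (sqr_mul_sqr q_neq0 (erefl nuz) nuzE).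
split; first exact: (sqr_mul_sqr q_neq0 (erefl nux) nuxE).
split; first exact: (sqr_mul_sqr q_neq0 (erefl nuy) nuyE).
split; first exact: (sqr_mul_sqr_swap q_neq0 (erefl nuz) nuzE).
split; first exact: (sqr_mul_sqr_swap q_neq0 (erefl nux) nuxE).
exact: (sqr_mul_sqr_swap q_neq0 (erefl nuy) nuyE).
Qed.
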